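(* Let $q$ be a power of an odd prime. Let $\tau'$ be a fixed $(P_0',\ell')$-involution in $\mathrm{PGU}(3,q)$, i.e. an involutory homology with center $P_0'$ and axis $\ell'$, where $P_0'\in\ell$, $P_0'\notin\mathcal H_q$, and $\ell'$ is the polar line of $P_0'$ with respect to the unitary polarity associated to $\mathcal H_q$. Then $$\mathcal M_q = H\rtimes Z(C_{\mathrm{PGU}(3,q)}(\tau'))\cong SL(2,q)\rtimes C_{q+1},$$ where $Z(C_{\mathrm{PGU}(3,q)}(\tau'))$ is the center of the centralizer of $\tau'$ in $\mathrm{PGU}(3,q)$.
   Context: Let $q=p^h$ with $p$ an odd prime and let $\mathbb K$ be the algebraic closure of $\mathbb F_{q^2}$. The Hermitian curve $\mathcal H_q$ is taken in the plane model $XY^q-YX^q+\omega Z^{q+1}=0$, where $\omega\in\mathbb K$ is fixed with $\omega^{q-1}=-1$. Its automorphism group is $\mathrm{PGU}(3,q)$, the group of projectivities preserving $\mathcal H_q$. A unitary polarity of $PG(2,q^2)$ is associated with $\mathcal H_q$, its isotropic points being the points of $\mathcal H_q(\mathbb F_{q^2})$. Let $P_0=(0:0:1)\notin\mathcal H_q$ and let $\ell: Z=0$ be its polar line. $\mathcal M_q$ is the stabilizer of $P_0$ (equivalently of $\ell$) in $\mathrm{PGU}(3,q)$; it consists of the maps $(X,Y,Z)\mapsto(aX+bY,cX+dY,Z)$ with $ac^q-a^qc=0$, $bd^q-b^qd=0$, $bc^q-a^qd=-1$, $ad^q-b^qc=1$. $H$ is the subgroup of $\mathcal M_q$ of those maps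 with $a,b,c,d\in\mathbb F_q$ and $ad-bc=1$, so $H\cong SL(2,q)$. A homology with center $P$ and axis $m$ ($P\notin m$) is a projectivity preserving every line through $P$ and fixing every point of $m$. $C_n$ denotes a cyclic group of order $n$; the product is an internal semidirect product with $H$ normal. *)

(* Defs.v *)
From HB Require Import structures.
From mathcomp Require Import all_boot all_order all_algebra all_fingroup.
From mathcomp Require Import all_solvable all_field boolp.

Set Implicit Arguments.
Unset Strict Implicit.
Unset Printing Implicit Defensive.

Import GRing.Theory.
Local Open Scope ring_scope.

(* Points of the projective plane are given by nonzero row vectors (X, Y, Z), *)
(* lines by the row spaces of 3 x 3 matrices of rank 2.  Projectivities act   *)
(* on the right, v |-> v *m M, so that composition from left to right is the  *)
(* product of 'GL_3.                                                          *)

Definition PGL3 (F : finFieldType) := coset_of 'Z('GL_3[F])%g.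

(* A matrix inducing the projectivity g, well defined up to a scalar. *)
Definition proj_mx3 (F : finFieldType) (g : PGL3 F) : 'M[F]_3 :=
  GLval (repr g).

Definition fixes_point (F : finFieldType) (g : PGL3 F) (P : 'rV[F]_3) : bool :=
  (P *m proj_mx3 g == P)%MS.

Definition preserves_line (F : finFieldType) (g : PGL3 F) (m : 'M[F]_3) : bool :=
  (m *m proj_mx3 g == m)%MS.

Definition is_homology (F : finFieldType) (g : PGL3 F)
    (P : 'rV[F]_3) (m : 'M[F]_3) : Prop :=
  [/\ ~~ (P <= m)%MS,
      forall l : 'M[F]_3, \rank l = 2%N -> (P <= l)%MS -> preserves_line g l
    & forall Q : 'rV[F]_3, Q != 0 -> (Q <= m)%MS -> fixes_point g Q].

Definition herm_eq (K : fieldType) (q : nat) (omega : K) (v : 'rV[K]_3) : K :=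
  v 0 0 * v 0 1 ^+ q - v 0 1 * v 0 0 ^+ q + omega * v 0 2 ^+ q.+1.

(* The sesquilinear form (skew-Hermitian over the field of order q ^ 2, as    *)
(* omega ^ q = - omega) with herm_form v v = herm_eq v.                       *)
Definition herm_form (K : fieldType) (q : nat) (omega : K)
    (u v : 'rV[K]_3) : K :=
  u 0 0 * v 0 1 ^+ q - u 0 1 * v 0 0 ^+ q + omega * (u 0 2 * v 0 2 ^+ q).

Definition on_hermitian (K : fieldType) (q : nat) (omega : K)
    (v : 'rV[K]_3) : bool :=
  herm_eq q omega v == 0.

Section HermitianGroups.

Variables (Fq F : finFieldType) (K : fieldType).
Variables (j : {rmorphism Fq -> F}) (iota : {rmorphism F -> K}).
Variables (q : nat) (omega : K).

Definition is_polar_line (P : 'rV[F]_3) (l : 'M[F]_3) : Prop :=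
  \rank l = 2%N /\
  forall v : 'rV[F]_3,
    (v <= l)%MS = (herm_form q omega (map_mx iota v) (map_mx iota P) == 0).

(* The curve is preserved as a set of points of the plane over K. *)
Definition PGU3 : {set PGL3 F} :=
  [set g | `[< forall v : 'rV[K]_3, v != 0 ->
     on_hermitian q omega (v *m map_mx iota (proj_mx3 g))
       = on_hermitian q omega v >]].

Definition P0 : 'rV[F]_3 := delta_mx 0 2.

(* The line Z = 0. *)
Definition ell : 'M[F]_3 := pid_mx 2.

Definition Mq : {set PGL3 F} := [set g in PGU3 | fixes_point g P0].

(* For A with rows (a, c) and (b, d), the block matrix below maps (X, Y, Z)   *)
(* to (a X + b Y, c X + d Y, Z).                                              *)
Definition Hq : {set PGL3 F} :=
  [set g in Mq | [exists A : 'M[Fq]_2, (\det A == 1) &&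
     [exists u in (g : {set {'GL_3[F]}}),
        GLval u == (block_mx (map_mx j A) 0 0 1%:M : 'M[F]_(2 + 1))]]].

End HermitianGroups.

Definition SL2 (k : finFieldType) : {set {'GL_2[k]}} :=
  [set A | \det (GLval A) == 1].

(* Main.v *)
Require Import Defs.
From HB Require Import structures.
From mathcomp Require Import all_boot all_order all_algebra all_fingroup.
From mathcomp Require Import all_solvable all_field boolp.
From mathcomp Require Import ring.

Set Implicit Arguments.
Unset Strict Implicit.
Unset Printing Implicit Defensive.

Import GRing.Theory.
Local Open Scope ring_scope.

(** Put s x = x ^ q, the involution of F, and J for the Gram matrix of the
    skew-Hermitian form whose isotropic vectors are the points of the curve.

    A projectivity preserves the curve exactly when its matrices are
    similitudes of J, that is M J M^* = c J ([mem_PGU3]).  Only the F-rational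
    points are needed for the direct implication: two skew-Hermitian forms
    with the same rational isotropic vectors are proportional
    ([isotropic_proportional]).  If moreover M has a non-isotropic eigenvector
    v M = d v, then c = d s(d), so dividing M by d yields an isometry fixing v;
    this is how all matrices below are normalized.

    Taking v = P0 shows that M_q is the isomorphic image of the unitary group
    U of the plane Z = 0 ([Mq_embed]).  In dimension 2 the form is the
    alternating form twisted by s, and A J A^T = det(A) J turns the unitary
    condition into s(A) = A / det A.  Hence det(A)^(q+1) = 1 on U, and the
    elements of determinant 1 are those with entries in the field of order q:
    they form SL(2, q), whose image is H.  If a is a non-isotropic vector of
    the plane Z = 0, the homologies with center a, axis the polar of a and
    ratio z, z^(q+1) = 1, lie in U and have determinant z, so they form a cyclic
    complement of order q + 1 to the kernel of det
    ([special_unitary2_sdprod]).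

    It remains to see that these homologies, for a = P', form the center of
    the centralizer of tau'.  The involution tau' has ratio -1
    ([polar_involution_unique]).  An element centralizing it fixes P'; hence it
    commutes with all homologies with the same center and axis.  A central
    element commutes with the involutory homologies centered at the
    non-isotropic points of the polar line of P', so it fixes each of these
    points; it therefore acts on that line as a scalar, and is a homology
    ([center_involution_centralizer]). *)

(** * Roots of unity and Frobenius maps *)

Lemma finField_prim_root (F : finFieldType) :
  exists z : F, #|F|.-1.-primitive_root z.
Proof.
have F1 : (0 < #|F|.-1)%N.
  by rewrite -subn1 subn_gt0 (cardD1 0) (cardD1 1) !inE oner_eq0.
pose rs := [seq x <- enum F | x != 0].
have allr : all #|F|.-1.-unity_root rs.
  apply/allP => x; rewrite mem_filter unity_rootE => /andP[x0 _].
  apply/eqP/(mulfI x0).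
  by rewrite -exprS prednK ?mulr1 ?expf_card // (cardD1 0).
have size_rs : (#|F|.-1 <= size rs)%N.
  have := count_predC (pred1 (0 : F)) (enum F).
  by rewrite count_uniq_mem ?enum_uniq // mem_enum -cardE size_filter => <-.
have /hasP[z _ zP] := has_prim_root F1 allr (filter_uniq _ (enum_uniq F)) size_rs.
by exists z.
Qed.

(** Packaging x |-> x ^ (p ^ h) as a ring morphism gives access to the theory
    of semilinear maps, both over F and over its closure K. *)
Lemma frobenius_power (R : comNzRingType) p h :
  p \in [char R] ->
  exists s : {rmorphism R -> R}, forall x, s x = x ^+ (p ^ h).
Proof.
move=> pR.
have qN : [char R].-nat (p ^ h)%N.
  by rewrite pnatX pnatE ?pR //; case/andP: pR.
have q_gt0 : (0 < p ^ h)%N by case/andP: pR => /prime_gt0 p0 _; rewrite expn_gt0 p0.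
pose s (x : R) := x ^+ (p ^ h).
have sB : zmod_morphism s.
  move=> x y; apply: (addIr (s y)); rewrite subrK /s -exprDn_pchar ?subrK //.
have sM : monoid_morphism s by split=> [|x y]; rewrite /s ?expr1n ?exprMn.
pose sb := GRing.isZmodMorphism.Build _ _ s sB.
pose sm := GRing.isMonoidMorphism.Build _ _ s sM.
pose s' : {rmorphism R -> R} := HB.pack s sb sm.
by exists s'.
Qed.

Section QuadraticExtension.
Variables (q : nat) (F : finFieldType) (cardF : #|F| = (q ^ 2)%N).

Lemma card_sq_pred : #|F|.-1 = (q.-1 * q.+1)%N.
Proof. by rewrite cardF -subn1 -(exp1n 2) subn_sqr subn1 addn1. Qed.

Lemma norm1_prim_root : exists z : F, q.+1.-primitive_root z.
Proof.
have [g gP] := finField_prim_root F.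
have := dvdn_prim_root gP (m := q.+1).
by rewrite card_sq_pred dvdn_mull // => /(_ isT) ?; eexists; eassumption.
Qed.

(** The nonzero fixed elements are the (q-1)-th roots of unity, all of which
    are powers of the image of a generator of the units of [Fq]. *)
Lemma subfield_fixed (Fq : finFieldType) (j : {rmorphism Fq -> F}) :
  #|Fq| = q -> forall x : F, x ^+ q = x -> exists y, x = j y.
Proof.
move=> cardFq x xq.
have [->|x0] := eqVneq x 0; first by exists 0; rewrite rmorph0.
have [e eP] := finField_prim_root Fq.
have x1 : x ^+ #|Fq|.-1 = 1.
  apply: (mulfI x0); rewrite -exprS cardFq prednK ?mulr1 //.
  by rewrite -cardFq (cardD1 0).
rewrite -(fmorph_primitive_root j) in eP.
by have [i ->] := prim_rootP eP x1; exists (e ^+ i); rewrite rmorphXn.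
Qed.

(** Since q + 1 is even, omega is a (q^2 - 1)-th root of unity, so that it is
    a power of the image of a generator of the units of F. *)
Lemma omega_rational (K : fieldType) (iota : {rmorphism F -> K}) (omega : K) :
  odd q -> omega ^+ q.-1 = -1 -> exists2 w : F, iota w = omega & w ^+ q.-1 = -1.
Proof.
move=> oq om; have [g gP] := finField_prim_root F.
rewrite -(fmorph_primitive_root iota) in gP.
have o1 : omega ^+ #|F|.-1 = 1.
  by rewrite card_sq_pred exprM om -signr_odd /= oq.
have [i iE] := prim_rootP gP o1.
exists (g ^+ i); first by rewrite rmorphXn iE.
by apply: (fmorph_inj iota); rewrite rmorphN1 rmorphXn /= rmorphXn /= -iE.
Qed.

End QuadraticExtension.

(** * Matrices and projectivities *)

Section ProjectiveGroup.
Variable F : finFieldType.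
Implicit Types u v : {'GL_3[F]}.

Definition pgl : {'GL_3[F]} -> PGL3 F := coset 'Z('GL_3[F])%g.

Lemma GL3_norm u : u \in 'N('Z('GL_3[F]))%g.
Proof. by have := subsetP (gFnorm _ 'GL_3[F]) u; apply; rewrite inE. Qed.

Lemma pglM : {morph pgl : u v / (u * v)%g}.
Proof. by move=> u v; rewrite /pgl morphM ?GL3_norm. Qed.

Lemma pgl_repr (g : PGL3 F) : pgl (repr g) = g.
Proof. exact: coset_reprK. Qed.

(** Commuting with the transvections 1 + E_ik, hence with every E_ik, i != k,
    already forces M to be scalar. *)
Lemma scalar_of_commute (M : 'M[F]_3) :
  (forall N, N \in unitmx -> N *m M = M *m N) -> exists c, M = c%:M.
Proof.
move=> cM.
have cE i k : i != k -> delta_mx i k *m M = M *m delta_mx i k :> 'M_3.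
  move=> ik; have: 1%:M + delta_mx i k \in @unitmx F 3.
    pose N : 'M[F]_3 := 1%:M - delta_mx i k.
    suff /mulmx1_unit[] : (1%:M + delta_mx i k) *m N = 1%:M by [].
    rewrite mulmxBr mulmxDl !mulmx1 mulmxDl mul1mx mul_delta_mx_cond.
    by rewrite eq_sym (negbTE ik) mulr0n addr0 addrK.
  by move/cM; rewrite mulmxDl mulmxDr mul1mx mulmx1 => /addrI.
have entries i k r s : i != k ->
    (r == i)%:R * M k s = M r i * (s == k)%:R.
  move/cE/matrixP/(_ r s); rewrite [LHS]mxE [RHS]mxE.
  rewrite (bigD1 k) //= big1 => [|t tk]; last first.
    by rewrite mxE (negbTE tk) andbF mul0r.
  rewrite (bigD1 i) //= big1 => [|t ti]; last first.
    by rewrite mxE (negbTE ti) mulr0.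
  by rewrite !mxE !eqxx andbT !addr0.
exists (M 0 0); apply/matrixP => i k; rewrite !mxE.
have [<-|ik] := eqVneq i k; last first.
  have := entries k i k k; rewrite eq_sym ik eqxx (negbTE ik) => /(_ isT).
  by rewrite mul1r mulr0.
have [->//|i0] := eqVneq i 0.
by have /(_ i0) := entries i 0 i 0; rewrite !eqxx mul1r mulr1 => ->.
Qed.

Lemma mem_center_GL3 u :
  reflect (exists c, GLval u = c%:M) (u \in 'Z('GL_3[F])%g).
Proof.
rewrite inE inE /=; apply: (iffP centP) => [cu | [c uE] v _].
  apply: scalar_of_commute => N N_unit.
  have /(_ (in_setT _))/(congr1 (@GLval _ _)) := cu (FinRing.Unit N_unit).
  by [].
apply: val_inj; change (GLval u *m GLval v = GLval v *m GLval u).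
by rewrite uE scalar_mxC.
Qed.

Lemma pgl_eqP u v :
  reflect (exists c, GLval u = c *: GLval v) (pgl u == pgl v).
Proof.
apply: (iffP eqP) => [uv | [c uE]].
  have /kercoset_rcoset := uv; case; rewrite ?GL3_norm // => z /mem_center_GL3[c zE] ->.
  by exists c; rewrite GL_MxE zE mul_scalar_mx.
have uvc : GLval (u * v^-1)%g = c%:M.
  by rewrite GL_ME GL_VE uE -scalerAl mulrV ?GL_unit // scalemx1.
rewrite -[u](mulgKV v) /pgl coset_kerl //; apply/mem_center_GL3.
by exists c.
Qed.

End ProjectiveGroup.

(** * Sesquilinear forms, similitudes and homologies *)

Section SesquilinearForm.
Variables (F : fieldType) (s : {rmorphism F -> F}).

Definition adjmx m n (A : 'M[F]_(m, n)) : 'M[F]_(n, m) := (map_mx s A)^T.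

Lemma adjmxM m n r (A : 'M[F]_(m, n)) (B : 'M_(n, r)) :
  adjmx (A *m B) = adjmx B *m adjmx A.
Proof. by rewrite /adjmx map_mxM trmx_mul. Qed.

Lemma adjmxD m n (A B : 'M[F]_(m, n)) : adjmx (A + B) = adjmx A + adjmx B.
Proof. by rewrite /adjmx map_mxD linearD. Qed.

Lemma adjmxZ m n c (A : 'M[F]_(m, n)) : adjmx (c *: A) = s c *: adjmx A.
Proof. by rewrite /adjmx map_mxZ linearZ. Qed.

Lemma adjmx1 n : adjmx 1%:M = 1%:M :> 'M[F]_n.
Proof. by rewrite /adjmx map_mx1 trmx1. Qed.

Lemma adjmxK (sK : involutive s) m n (A : 'M[F]_(m, n)) : adjmx (adjmx A) = A.
Proof. by apply/matrixP => i k; rewrite !mxE sK. Qed.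

Variables (n : nat) (J : 'M[F]_n).

Definition sform (u v : 'rV[F]_n) : F := (u *m J *m adjmx v) 0 0.

Lemma sformDl u v w : sform (u + v) w = sform u w + sform v w.
Proof. by rewrite /sform !mulmxDl mxE. Qed.

Lemma sformZl c u v : sform (c *: u) v = c * sform u v.
Proof. by rewrite /sform -!scalemxAl mxE. Qed.

Lemma sformDr u v w : sform u (v + w) = sform u v + sform u w.
Proof. by rewrite /sform adjmxD mulmxDr mxE. Qed.

Lemma sformZr c u v : sform u (c *: v) = s c * sform u v.
Proof. by rewrite /sform adjmxZ -scalemxAr mxE. Qed.

Definition similitude c (M : 'M[F]_n) := M *m J *m adjmx M = c *: J.

Lemma sform_similitude c M u v :
  similitude c M -> sform (u *m M) (v *m M) = c * sform u v.
Proof.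
move=> simM; rewrite /sform adjmxM -!mulmxA (mulmxA M) (mulmxA _ _ (adjmx v)) simM.
by rewrite -scalemxAl -scalemxAr mxE mulmxA.
Qed.

(** A non-isotropic eigenvector expresses the multiplier of a similitude as a
    norm, so that the similitude can be rescaled to an isometry. *)
Lemma similitude_eigen c d M v :
  similitude c M -> sform v v != 0 -> v *m M = d *: v -> c = d * s d.
Proof.
move=> simM v0 vM; apply: (mulIf v0).
by rewrite -(sform_similitude _ _ simM) vM sformZl sformZr mulrA.
Qed.

Lemma similitudeZ a c M : similitude c M -> similitude (a * s a * c) (a *: M).
Proof.
by rewrite /similitude adjmxZ => simM; rewrite -!scalemxAl -scalemxAr simM !scalerA.
Qed.

Lemma similitudeM c d M N :
  similitude c M -> similitude d N -> similitude (c * d) (M *m N).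
Proof.
rewrite /similitude => simM simN; rewrite adjmxM -!mulmxA (mulmxA N) (mulmxA _ (adjmx N)).
by rewrite simN -scalemxAl -scalemxAr mulmxA simM scalerA mulrC.
Qed.

(** The map with ratio z on a, and identity on the polar hyperplane of a:
    v |-> v + ((z - 1) (v, a) / (a, a)) a. *)
Definition homology (a : 'rV[F]_n) (z : F) : 'M[F]_n :=
  1%:M + ((z - 1) / sform a a) *: (J *m adjmx a *m a).

Lemma mul_homology v a z :
  v *m homology a z = v + ((z - 1) / sform a a * sform v a) *: a.
Proof.
rewrite /homology mulmxDr mulmx1 -scalemxAr !mulmxA.
by rewrite [v *m J *m adjmx a]mx11_scalar mul_scalar_mx scalerA.
Qed.

Lemma homology_center a z : sform a a != 0 -> a *m homology a z = z *: a.
Proof.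
move=> a0; rewrite mul_homology divfK // -{1}[a]scale1r -scalerDl.
by rewrite addrC subrK.
Qed.

Lemma homology_axis a z v : sform v a = 0 -> v *m homology a z = v.
Proof. by move=> va; rewrite mul_homology va mulr0 scale0r addr0. Qed.

Lemma homology1 a : homology a 1 = 1%:M.
Proof. by rewrite /homology subrr mul0r scale0r addr0. Qed.

Lemma homologyM a z t : sform a a != 0 ->
  homology a z *m homology a t = homology a (z * t).
Proof.
move=> a0; apply/row_matrixP => i; rewrite !rowE mulmxA.
rewrite !mul_homology sformDl sformZl -addrA -scalerDl; congr (_ + _ *: _).
by field.
Qed.

Lemma homology_unit a z : sform a a != 0 -> z != 0 -> homology a z \in unitmx.
Proof.
move=> a0 z0; have /mulmx1_unit[] // : homology a z *m homology a z^-1 = 1%:M.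
by rewrite homologyM // mulfV // homology1.
Qed.

(** Every vector is the sum of a multiple of a and of a vector of the polar
    hyperplane of a, on both of which the two sides agree. *)
Lemma scalar_on_axis_homology a c d M : sform a a != 0 -> c != 0 ->
  a *m M = d *: a -> (forall v, sform v a = 0 -> v *m M = c *: v) ->
  M = c *: homology a (d / c).
Proof.
move=> a0 c0 aM axM; apply/row_matrixP => i; rewrite !rowE.
move: (delta_mx 0 i) => v; rewrite -scalemxAr mul_homology.
pose b := sform v a / sform a a.
have : (v - b *: a) *m M = c *: (v - b *: a).
  by apply: axM; rewrite -scaleNr sformDl sformZl mulNr divfK // subrr.
rewrite mulmxBl -scalemxAl aM => /eqP; rewrite subr_eq => /eqP ->.
rewrite scalerBr scalerDr -addrA; congr (_ + _).
rewrite !scalerA -scaleNr -scalerDl; congr (_ *: _).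
by rewrite /b; field; rewrite c0 a0.
Qed.

(** M preserves the eigenspace of the homology for the eigenvalue z. *)
Lemma commute_homology_center a z M : sform a a != 0 -> z != 1 ->
  M *m homology a z = homology a z *m M -> exists d, a *m M = d *: a.
Proof.
move=> a0 z1 cM; exists (sform (a *m M) a / sform a a).
have z1' : z - 1 != 0 by rewrite subr_eq0.
apply: (scalerI z1'); rewrite scalerBl scale1r.
have := mulmxA a M (homology a z).
rewrite cM mulmxA homology_center // -scalemxAl mul_homology => ->.
by rewrite addrAC subrr add0r scalerA mulrAC mulrA.
Qed.

(** All homologies with a given center and axis, except the identity, have the
    same centralizer: they are of the form 1 + t E for one and the same matrix
    E of rank 1, with t != 0. *)
Lemma commute_homology a z t M : sform a a != 0 -> z != 1 ->
  M *m homology a z = homology a z *m M -> M *m homology a t = homology a t *m M.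
Proof.
move=> a0 z1; rewrite /homology !mulmxDl !mulmxDr !mul1mx !mulmx1 => /addrI.
rewrite -!scalemxAr -!scalemxAl => /(scalerI _) -> //.
by rewrite mulf_neq0 ?invr_eq0 // subr_eq0.
Qed.

Lemma homology_commute_orth a b z t : sform a b = 0 -> sform b a = 0 ->
  homology a z *m homology b t = homology b t *m homology a z.
Proof.
move=> ab ba; apply/row_matrixP => i; rewrite !rowE !mulmxA !mul_homology.
by rewrite !sformDl !sformZl ab ba !mulr0 !addr0 -!addrA [_ *: a + _]addrC.
Qed.

Hypothesis (sK : involutive s) (Jskew : adjmx J = - J).

Lemma sform_skew u v : sform u v = - s (sform v u).
Proof.
have -> : s (sform v u) = (adjmx (v *m J *m adjmx u)) 0 0.
  by rewrite /adjmx [RHS]mxE [RHS]mxE.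
by rewrite !adjmxM adjmxK // Jskew mulNmx mulmxN mulmxA mxE opprK.
Qed.

Lemma homology_isometry a z : sform a a != 0 -> z * s z = 1 ->
  similitude 1 (homology a z).
Proof.
move=> a0 z1; rewrite /similitude scale1r; apply/matrixP => i k.
have entry (M : 'M[F]_n) : 
    M i k = (delta_mx 0 i *m M *m adjmx (delta_mx 0 k : 'rV_n) : 'M_1) 0 0.
  by rewrite /adjmx map_delta_mx trmx_delta -colE mxE -rowE !mxE.
rewrite [LHS]entry [RHS]entry -/(sform (delta_mx 0 i) (delta_mx 0 k)).
rewrite !mulmxA -!mulmxA -(adjmxM) !mulmxA -[LHS]/(sform _ _) !mul_homology.
rewrite !(sformDl, sformDr, sformZl, sformZr) [sform a (delta_mx _ _)]sform_skew.
rewrite !rmorphM rmorphB rmorph1 fmorphV.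
have -> : s (sform a a) = - sform a a by rewrite {2}[sform a a]sform_skew opprK.
have z0 : z != 0 by apply: contra_eq_neq z1 => ->; rewrite mul0r eq_sym oner_eq0.
have -> : s z = z^-1 by apply: (mulfI z0); rewrite z1 mulfV.
by field; rewrite oppr_eq0 a0 z0.
Qed.

End SesquilinearForm.

(** * The Hermitian curve and its form *)

Section HermitianForm.
Variables (F : fieldType).

(** The entries k - i are those of the standard alternating matrix, with rows
    (0, 1) and (-1, 0). *)
Definition skew2 : 'M[F]_2 := \matrix_(i, k) ((k : nat)%:R - (i : nat)%:R).

Definition herm_mx (w : F) : 'M[F]_3 := block_mx skew2 0 0 w%:M : 'M_(2 + 1).

(** The explicit table is used for entrywise computations, the block form for
    the relation with the plane Z = 0. *)
Lemma herm_mxE w : herm_mx w = \matrix_(i, k)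
  nth 0 (nth [::] [:: [:: 0; 1; 0]; [:: -1; 0; 0]; [:: 0; 0; w]] i) k.
Proof.
apply: etrans (@submxK F 2 1 2 1 _); rewrite /herm_mx.
apply: (f_equal4 (@block_mx F 2 1 2 1));
  apply/matrixP => -[[|[|[]]] //= ?] [[|[|[]]] //= ?]; rewrite !mxE //=;
  by rewrite ?subrr ?subr0 ?sub0r ?mulr1n.
Qed.

Lemma det2E (A : 'M[F]_2) : \det A = A 0 0 * A 1 1 - A 0 1 * A 1 0.
Proof.
rewrite (expand_det_row _ 0) !big_ord_recl big_ord0 /cofactor !det_mx11 !mxE /=.
rewrite addr0 expr0 expr1 mul1r mulN1r mulrN.
by congr (A _ _ * A _ _ - A _ _ * A _ _); apply: val_inj.
Qed.

Lemma matrix2P (A B : 'M[F]_2) :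
  A 0 0 = B 0 0 -> A 0 1 = B 0 1 -> A 1 0 = B 1 0 -> A 1 1 = B 1 1 -> A = B.
Proof.
have I2 (P : 'I_2 -> Prop) : P 0 -> P 1 -> forall i, P i.
  move=> P0 P1 [[|[|//]] li]; first by rewrite (_ : Ordinal li = 0) //; apply: val_inj.
  by rewrite (_ : Ordinal li = 1) //; apply: val_inj.
by move=> *; apply/matrixP; elim/I2; elim/I2.
Qed.

Lemma sum2 (f : 'I_2 -> F) : \sum_i f i = f 0 + f 1.
Proof. by rewrite !big_ord_recl big_ord0 addr0; congr (_ + f _); apply: val_inj. Qed.

Lemma skew2E :
  (skew2 0 0 = 0) * (skew2 0 1 = 1) * (skew2 1 0 = -1) * (skew2 1 1 = 0).
Proof. by do !split; rewrite !mxE /= ?subrr ?sub0r ?subr0. Qed.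

(** This ties the conjugate of a unitary 2 x 2 matrix to its determinant. *)
Lemma skew2_det (A : 'M[F]_2) : A *m skew2 *m A^T = \det A *: skew2.
Proof.
by apply: matrix2P; rewrite det2E !(skew2E, mxE, sum2); ring.
Qed.

Lemma skew2_unit : skew2 \in unitmx.
Proof.
by rewrite unitmxE det2E !skew2E mul0r sub0r mulrN1 opprK unitr1.
Qed.

Variable s : {rmorphism F -> F}.

Lemma adj_skew2 : adjmx s skew2 = - skew2.
Proof.
by apply: matrix2P; rewrite !(skew2E, mxE) ?rmorphN ?rmorph1 ?rmorph0 ?opprK ?oppr0.
Qed.

Lemma sform2E (a : 'rV[F]_2) : sform s skew2 a a = a 0 0 * s (a 0 1) - a 0 1 * s (a 0 0).
Proof. by rewrite /sform !(skew2E, mxE, sum2); ring. Qed.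

Lemma det_homology2 (a : 'rV[F]_2) z : sform s skew2 a a != 0 ->
  \det (homology s skew2 a z) = z.
Proof.
move=> a0; rewrite /homology; set t := (z - 1) / _.
have -> : z = 1 + t * sform s skew2 a a by rewrite /t divfK // addrC subrK.
clearbody t; rewrite sform2E det2E !(skew2E, mxE, sum2, big_ord1).
by rewrite (ord1 ord0) /= ?mulr1n; ring.
Qed.

Lemma sform3E (N : 'M[F]_3) (u v : 'rV[F]_3) : sform s N u v =
    (u 0 0 * N 0 0 + u 0 1 * N 1 0 + u 0 2 * N 2 0) * s (v 0 0)
  + (u 0 0 * N 0 1 + u 0 1 * N 1 1 + u 0 2 * N 2 1) * s (v 0 1)
  + (u 0 0 * N 0 2 + u 0 1 * N 1 2 + u 0 2 * N 2 2) * s (v 0 2).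
Proof.
have sum3 (f : 'I_3 -> F) : \sum_i f i = f 0 + f 1 + f 2.
  rewrite !big_ord_recl big_ord0 addr0 addrA.
  by congr (_ + f _ + f _); apply: val_inj.
by rewrite /sform !mxE !sum3 !mxE !sum3.
Qed.

Lemma herm_formE q w (u v : 'rV[F]_3) : (forall x, s x = x ^+ q) ->
  herm_form q w u v = sform s (herm_mx w) u v.
Proof.
by move=> sE; rewrite sform3E herm_mxE !mxE /= /herm_form -!sE; ring.
Qed.

Lemma herm_eqE q w (v : 'rV[F]_3) : (forall x, s x = x ^+ q) ->
  herm_eq q w v = sform s (herm_mx w) v v.
Proof. by move=> sE; rewrite -(herm_formE _ _ _ sE) /herm_form -exprS. Qed.

Section Isotropic.
Variables (w : F) (sK : involutive s) (two0 : (2 : F) != 0) (sw : s w = - w) (w0 : w != 0).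

Lemma adj_herm_mx : adjmx s (herm_mx w) = - herm_mx w.
Proof.
rewrite herm_mxE; apply/matrixP => i k; rewrite !mxE.
case: i => [[|[|[|[]]]]] //= _; case: k => [[|[|[|[]]]]] //= _;
  by rewrite ?rmorphN ?rmorph1 ?rmorph0 ?opprK ?oppr0.
Qed.

Lemma herm_mx_unit : herm_mx w \in unitmx.
Proof.
rewrite unitmxE /herm_mx (@det_ublock _ 2 1) det_mx11 mxE mulr1n unitrM.
by rewrite -unitmxE skew2_unit unitfE.
Qed.

(** The points (1 : 0 : 0), (0 : 1 : 0), (1 : 1 : 0) of the curve show that the
    upper left block of N is a multiple of the alternating one.  The points (x : y : 1) with
    x = (t - w / 2) a, y = 1 / s(a), where s(t) = t, also lie on it, and varying
    t and a in the resulting relation determines the remaining entries. *)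
Lemma isotropic_proportional (N : 'M[F]_3) : adjmx s N = - N ->
  (forall v, sform s (herm_mx w) v v = 0 -> sform s N v v = 0) ->
  N = N 0 1 *: herm_mx w.
Proof.
move=> Nskew iso.
have skew i k : s (N i k) = - N k i.
  by move/matrixP/(_ k i): Nskew; rewrite !mxE.
pose vec x y z : 'rV[F]_3 := \row_k nth 0 [:: x; y; z] k.
have isoE x y z : x * s y - y * s x + w * (z * s z) = 0 ->
    (x * N 0 0 + y * N 1 0 + z * N 2 0) * s x
    + (x * N 0 1 + y * N 1 1 + z * N 2 1) * s y
    + (x * N 0 2 + y * N 1 2 + z * N 2 2) * s z = 0.
  move=> vJ; have := iso (vec x y z); rewrite herm_mxE !sform3E !mxE /=; apply.
  by rewrite -[RHS]vJ; ring.
have N00 : N 0 0 = 0.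
  have := isoE 1 0 0; rewrite !rmorph0 !rmorph1 => <-; ring.
have N11 : N 1 1 = 0.
  have := isoE 0 1 0; rewrite !rmorph0 !rmorph1 => <-; ring.
have N10 : N 1 0 = - N 0 1.
  have := isoE 1 1 0; rewrite !rmorph0 !rmorph1 N00 N11 => E.
  by apply/eqP; rewrite -addr_eq0 -E; [apply/eqP|]; ring.
have sN01 : s (N 0 1) = N 0 1 by rewrite skew N10 opprK.
have sw2 : s (w / 2) = - (w / 2) by rewrite fmorph_div sw rmorph_nat mulNr.
have N20 : N 2 0 = - s (N 0 2) by rewrite skew opprK.
have N21 : N 2 1 = - s (N 1 2) by rewrite skew opprK.
have E a t : a != 0 -> s t = t ->
    (t - w / 2) * (a * N 0 2) - (t + w / 2) * (s a * s (N 0 2))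
    + (N 1 2 / s a - s (N 1 2) / a) = w * N 0 1 - N 2 2.
  move=> a0 st; have sa0 : s a != 0 by rewrite fmorph_eq0.
  have := isoE ((t - w / 2) * a) (s a)^-1 1.
  rewrite !rmorphM rmorphB sw2 st fmorphV sK rmorph1 N00 N11 N10.
  rewrite N20 N21 => H.
  apply/eqP; rewrite -subr_eq0; apply/eqP; rewrite -[RHS]H; first by field; rewrite two0 a0 sa0.
  by field; rewrite two0 a0 sa0.
(* The difference of the relations for t = 1 and t = 0; the values a = 1 and
   a = w then show that N 0 2 vanishes. *)
have D a : a != 0 -> a * N 0 2 = s a * s (N 0 2).
  move=> a0; apply/eqP; rewrite -subr_eq0; apply/eqP.
  have := E a 1 a0 (rmorph1 _); rewrite -(E a 0 a0 (rmorph0 _)).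
  move/(addIr _)/eqP; rewrite -subr_eq0 => /eqP <-; ring.
have eq_opp0 (x : F) : x = - x -> x = 0.
  by move/eqP; rewrite -addr_eq0 -mulr2n -mulr_natl mulf_eq0 (negbTE two0) => /eqP.
have N02 : N 0 2 = 0.
  have := D w w0; have := D 1 (oner_neq0 _); rewrite rmorph1 !mul1r => <-.
  by rewrite sw mulNr => /eq_opp0/eqP; rewrite mulf_eq0 (negbTE w0) => /eqP.
have N12f a : a != 0 -> N 1 2 / s a - s (N 1 2) / a = w * N 0 1 - N 2 2.
  by move=> a0; rewrite -(E a 0 a0 (rmorph0 _)) N02 rmorph0 !mulr0 subr0 add0r.
(* Replacing a by - a changes the sign of the left-hand side only. *)
have N22 : N 2 2 = w * N 0 1.
  have k1 := N12f 1 (oner_neq0 _).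
  have : w * N 0 1 - N 2 2 = - (w * N 0 1 - N 2 2).
    have N1 : -1 != 0 :> F by rewrite oppr_eq0 oner_eq0.
    rewrite -{1}(N12f _ N1) -k1 rmorphN1 rmorph1 !invrN !invr1.
    by rewrite !mulrN !mulr1 opprB opprK addrC.
  by move/eq_opp0/eqP; rewrite subr_eq0 => /eqP.
have N12 : N 1 2 = 0.
  have := N12f w w0; have := N12f 1 (oner_neq0 _).
  rewrite N22 subrr rmorph1 !divr1 => /eqP; rewrite subr_eq0 => /eqP <-.
  rewrite sw invrN mulrN -opprD => /eqP; rewrite oppr_eq0 -mulr2n -(mulr_natl (_ / w)).
  by rewrite !mulf_eq0 invr_eq0 (negbTE w0) (negbTE two0) orbF => /eqP.
rewrite N02 rmorph0 oppr0 in N20.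
rewrite N12 rmorph0 oppr0 in N21.
have I3 (P : 'I_3 -> Prop) : P 0 -> P 1 -> P 2 -> forall i, P i.
  move=> P0 P1 P2 [[|[|[|//]]] li].
  - by rewrite (_ : Ordinal li = 0) //; apply: val_inj.
  - by rewrite (_ : Ordinal li = 1) //; apply: val_inj.
  by rewrite (_ : Ordinal li = 2) //; apply: val_inj.
apply/matrixP; elim/I3; elim/I3; rewrite herm_mxE !mxE /=;
  by rewrite ?N00 ?N11 ?N10 ?N02 ?N12 ?N20 ?N21 ?N22 ?mulr0 ?mulr1 ?mulrN1 // mulrC.
Qed.

End Isotropic.
End HermitianForm.

(** * The unitary group of a plane *)

Section UnitaryGroup2.
Variables (F : finFieldType) (s : {rmorphism F -> F}) (sK : involutive s).
Local Notation J := (skew2 F).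
Implicit Types A B : {'GL_2[F]}.

Lemma GLdetM A B : \det (GLval (A * B)%g) = \det (GLval A) * \det (GLval B).
Proof. exact: det_mulmx. Qed.

Lemma GLdetV A : \det (GLval A^-1%g) = (\det (GLval A))^-1.
Proof. exact: det_inv. Qed.

Definition unitary2 : {set {'GL_2[F]}} :=
  [set A : {'GL_2[F]} | GLval A *m J *m adjmx s (GLval A) == J].

Lemma unitary2P A : reflect (similitude s J 1 (GLval A)) (A \in unitary2).
Proof. by rewrite inE /similitude scale1r; apply: eqP. Qed.

Lemma unitary2_group_set : group_set unitary2.
Proof.
apply/group_setP; split=> [|A B /unitary2P UA /unitary2P UB].
  by rewrite inE GL_1E mul1mx adjmx1 mulmx1.
by apply/unitary2P; rewrite GL_MxE -[1]mulr1; apply: similitudeM.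
Qed.
Canonical unitary2_group := Group unitary2_group_set.

Lemma skew2_det_neq0 : \det J != 0.
Proof. by have := skew2_unit F; rewrite unitmxE unitfE. Qed.

(** Compare the unitary condition with A J A^T = det(A) J, and cancel A J. *)
Lemma unitary2_conj A : A \in unitary2 ->
  map_mx s (GLval A) = (\det (GLval A))^-1 *: GLval A.
Proof.
move=> /unitary2P UA; rewrite /similitude scale1r in UA; apply: trmx_inj.
have AJ : GLval A *m J \in unitmx by rewrite unitmx_mul GL_unitmx skew2_unit.
apply: (can_inj (mulKmx AJ)); rewrite linearZ /= -scalemxAr skew2_det.
by rewrite scalerA mulVf; [rewrite scale1r; apply: UA | apply: (GL_det A)].
Qed.

Lemma unitary2_det A : A \in unitary2 ->
  \det (GLval A) * s (\det (GLval A)) = 1.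
Proof.
move/unitary2P; rewrite /similitude scale1r => /(congr1 determinant).
rewrite !det_mulmx det_tr det_map_mx.
by rewrite mulrAC -[RHS]mul1r => /(mulIf skew2_det_neq0).
Qed.

Definition special_unitary2 : {set {'GL_2[F]}} :=
  [set A in unitary2 | \det (GLval A) == 1].

Lemma special_unitary2E A :
  (A \in special_unitary2) = (A \in unitary2) && (\det (GLval A) == 1).
Proof. exact: in_set. Qed.

Lemma special_unitary2P A :
  reflect (similitude s J 1 (GLval A) /\ \det (GLval A) = 1)
          (A \in special_unitary2).
Proof.
rewrite special_unitary2E; apply: (iffP andP) => [[/unitary2P ? /eqP //]|[UA dA]].
by split; [apply/unitary2P | apply/eqP].
Qed.

Lemma special_unitary2_group_set : group_set special_unitary2.
Proof.
apply/group_setP; split=> [|A B].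
  by rewrite special_unitary2E group1 GL_1E det1 /=.
rewrite !special_unitary2E GLdetM.
by case/andP=> UA /eqP-> /andP[UB /eqP->]; rewrite groupM ?mulr1 /=.
Qed.
Canonical special_unitary2_group := Group special_unitary2_group_set.

(** The determinant maps [unitary2] to the (q+1)-th roots of unity with kernel
    [special_unitary2], and a homology of ratio z has determinant z: its powers
    are a section of the determinant. *)
Lemma special_unitary2_sdprod q (z : F) (a : 'rV[F]_2) (u : {'GL_2[F]}) :
  (forall x, s x = x ^+ q) -> q.+1.-primitive_root z ->
  sform s J a a != 0 -> GLval u = homology s J a z ->
  (special_unitary2 ><| <[u]> = unitary2)%g /\ #[u]%g = q.+1.
Proof.
move=> sE zP a0 uE.
have z_norm : z * s z = 1 by rewrite sE -exprS prim_expr_order.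
have Uu : u \in unitary2.
  apply/unitary2P; rewrite uE; apply: homology_isometry => //.
  exact: adj_skew2.
have uX i : GLval (u ^+ i)%g = homology s J a (z ^+ i).
  elim: i => [|i IHi]; first by rewrite GL_1E homology1.
  by rewrite expgS GL_ME IHi uE exprS -homologyM.
have detu i : \det (GLval (u ^+ i)%g) = z ^+ i by rewrite uX det_homology2.
have ou : #[u]%g = q.+1.
  apply/eqP; rewrite eqn_dvd; apply/andP; split; last first.
    by rewrite (prim_order_dvd zP) -detu expg_order GL_1E det1.
  rewrite order_dvdn; apply/eqP/val_inj.
  by rewrite /= -[LHS]/(GLval _) uX (prim_expr_order zP) homology1.
split=> //; rewrite sdprodE.
- apply/eqP; rewrite eqEsubset; apply/andP; split.
    rewrite mul_subG ?cycle_subG //; apply/subsetP => A.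
    by rewrite special_unitary2E => /andP[].
  apply/subsetP => A UA.
  have [|i dA] := prim_rootP zP (x := \det (GLval A)).
    by rewrite exprS -sE unitary2_det.
  rewrite -[A](mulgKV (u ^+ i)%g) mem_mulg ?groupV ?mem_cycle //.
  rewrite special_unitary2E groupM ?groupV ?groupX //.
  rewrite GLdetM GLdetV detu -dA.
  by rewrite mulfV ?eqxx //; apply: (GL_det A).
- apply/subsetP => v /cycleP[i ->{v}]; rewrite inE.
  apply/subsetP => _ /imsetP[A SA ->].
  move: SA; rewrite !special_unitary2E => /andP[UA /eqP dA].
  rewrite groupJ ?groupX // /conjg !GLdetM dA mul1r GLdetV.
  by rewrite mulVf ?eqxx //; apply: (GL_det (u ^+ i)%g).
apply/trivgP/subsetP => v /setIP[]; rewrite special_unitary2E.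
move=> /andP[_ /eqP dv] /cycleP[i vE].
by rewrite inE vE -order_dvdn ou (prim_order_dvd zP) -detu -vE dv.
Qed.

End UnitaryGroup2.

Lemma SL2_group_set (k : finFieldType) : group_set (SL2 k).
Proof.
apply/group_setP; split=> [|A B]; first by rewrite inE GL_1E det1.
by rewrite !inE GLdetM => /eqP-> /eqP->; rewrite mulr1.
Qed.
Canonical SL2_group k := Group (SL2_group_set k).

Section SpecialLinear.
Variables (Fq F : finFieldType) (j : {rmorphism Fq -> F}).

Lemma map_GL2_subproof (A : {'GL_2[Fq]}) : map_mx j (GLval A) \is a GRing.unit.
Proof. by rewrite map_mx_unit GL_unit. Qed.

Definition map_GL2 (A : {'GL_2[Fq]}) : {'GL_2[F]} := FinRing.Unit (map_GL2_subproof A).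

Lemma map_GL2M : {in [set: {'GL_2[Fq]}] &, {morph map_GL2 : A B / (A * B)%g}}.
Proof. by move=> A B _ _; apply: val_inj; rewrite /= map_mxM. Qed.
Canonical map_GL2_morphism := Morphism map_GL2M.

Lemma map_GL2_inj : ('injm map_GL2)%g.
Proof.
apply/injmP => A B _ _ /(congr1 (@GLval _ _))/= AB; apply: val_inj.
exact: (map_mx_inj AB).
Qed.

(** A unitary matrix of determinant 1 is fixed by s, so that its entries come
    from [Fq]. *)
Lemma map_SL2 q (s : {rmorphism F -> F}) :
  #|Fq| = q -> (forall x, s x = x ^+ q) ->
  (map_GL2 @* SL2 Fq)%g = special_unitary2 s.
Proof.
move=> cardFq sE; apply/setP => A; apply/morphimP/special_unitary2P.
  case=> B _; rewrite inE => /eqP dB -> /=; rewrite det_map_mx dB rmorph1; split=> //.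
  have sj (y : Fq) : s (j y) = j y by rewrite sE -rmorphXn -cardFq expf_card.
  rewrite /similitude (_ : adjmx s _ = (map_mx j (GLval B))^T); last first.
    by apply/matrixP => i k; rewrite !mxE.
  by rewrite skew2_det det_map_mx dB rmorph1.
case=> UA dA; have /unitary2P/unitary2_conj := UA; rewrite dA invr1 scale1r => sA.
have jA i k : exists y, GLval A i k == j y.
  have [|y ->] := subfield_fixed j cardFq (x := GLval A i k); last by exists y.
  by rewrite -sE; move/matrixP/(_ i k): sA; rewrite mxE.
pose B : 'M[Fq]_2 := \matrix_(i, k) xchoose (jA i k).
have BA : map_mx j B = GLval A.
  by apply/matrixP => i k; rewrite !mxE; apply/esym/eqP/(xchooseP (jA i k)).
have dB : \det B = 1 by apply: (fmorph_inj j); rewrite -det_map_mx BA dA rmorph1.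
have Bu : B \is a GRing.unit by rewrite -[_ \in _]/(B \in unitmx) unitmxE dB unitr1.
exists (FinRing.Unit Bu); rewrite ?inE //= ?dB //.
by apply: val_inj; rewrite /= BA.
Qed.

End SpecialLinear.

(** * The stabilizer of P0 as a unitary group *)

Section Embedding.
Variables (F : finFieldType) (s : {rmorphism F -> F}) (w : F).

Definition block1 (A : 'M[F]_2) : 'M[F]_3 := block_mx A 0 0 1%:M : 'M_(2 + 1).

Lemma block1M A B : block1 (A *m B) = block1 A *m block1 B.
Proof.
rewrite /block1 (mulmx_block A 0 0 1%:M B 0 0 1%:M).
by rewrite !mulmx0 !mul0mx !mulmx1 !addr0 add0r.
Qed.

Lemma block1_inj c A B : block1 A = c *: block1 B -> A = B.
Proof.
rewrite /block1 => E.
have := E; rewrite (scale_block_mx c B 0 0 1%:M).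
case/(@eq_block_mx _ 2 1 2 1) => AB _ _.
move/matrixP/(_ 0 0); rewrite !mxE !mulr1n mulr1 => c1.
by rewrite AB -c1 scale1r.
Qed.

Lemma block1_unit A : A \in unitmx -> block1 A \is a GRing.unit.
Proof.
rewrite (_ : (_ \is a _) = (block1 A \in unitmx)) //.
by rewrite !unitmxE (@det_ublock _ 2 1) det1 mulr1.
Qed.

Lemma similitude_block1 A :
  similitude s (herm_mx w) 1 (block1 A) <-> similitude s (skew2 F) 1 A.
Proof.
rewrite /similitude !scale1r.
have -> : block1 A *m herm_mx w *m adjmx s (block1 A) =
    block_mx (A *m skew2 F *m adjmx s A) 0 0 w%:M :> 'M_(2 + 1).
  rewrite /block1 /herm_mx /adjmx (map_block_mx s A 0 0 (1%:M : 'M_1)) (@tr_block_mx _ 2 1 2 1).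
  rewrite !(@mulmx_block _ 2 1 2 1 2 1) map_mx1 trmx1 !map_mx0 !trmx0.
  by rewrite !(mulmx0, mul0mx, mulmx1, mul1mx, addr0, add0r).
by split=> [/(@eq_block_mx _ 2 1 2 1)[] //|-> //].
Qed.

Lemma sform_row_mx0 (a : 'rV[F]_2) :
  sform s (herm_mx w) (row_mx a 0 : 'rV_(2 + 1)) (row_mx a 0 : 'rV_(2 + 1)) =
  sform s (skew2 F) a a.
Proof.
rewrite /sform /herm_mx /adjmx (map_row_mx s a (0 : 'M_(1, 1))) (@tr_row_mx _ 1 2 1).
rewrite map_mx0 trmx0 (@mul_row_block _ 1 2 1 2 1) !(mulmx0, mul0mx, addr0, add0r).
by rewrite (@mul_row_col _ 1 2 1 1) mulmx0 addr0.
Qed.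

Lemma homology_block1 (a : 'rV[F]_2) z :
  homology s (herm_mx w) (row_mx a 0 : 'rV_(2 + 1)) z =
  block1 (homology s (skew2 F) a z).
Proof.
rewrite /homology.
have -> : herm_mx w *m adjmx s (row_mx a 0 : 'rV_(2 + 1)) *m (row_mx a 0 : 'rV_(2 + 1))
  = block_mx (skew2 F *m adjmx s a *m a) 0 0 0 :> 'M_(2 + 1).
  rewrite /herm_mx /adjmx (map_row_mx s a (0 : 'M_(1, 1)))
    (@tr_row_mx _ 1 2 1) map_mx0 trmx0.
  rewrite (@mul_block_col _ 2 1 2 1 1) !(mulmx0, mul0mx, addr0, add0r).
  by rewrite (@mul_col_row _ 2 1 1 2 1) !(mulmx0, mul0mx).
rewrite sform_row_mx0.
rewrite (_ : 1%:M = block_mx 1%:M 0 0 1%:M :> 'M_(2 + 1)); last first.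
  exact: scalar_mx_block.
rewrite /block1 (@scale_block_mx _ 2 1 2 1).
by rewrite (@add_block_mx _ 2 1 2 1) !scaler0 !addr0.
Qed.


Definition embed3 (A : {'GL_2[F]}) : {'GL_3[F]} := FinRing.Unit (block1_unit (GL_unitmx A)).
Definition embed (A : {'GL_2[F]}) : PGL3 F := pgl (embed3 A).

Lemma embedM : {in [set: {'GL_2[F]}] &, {morph embed : A B / (A * B)%g}}.
Proof.
move=> A B _ _; rewrite /embed -pglM; congr pgl; apply: val_inj; exact: block1M.
Qed.
Canonical embed_morphism := Morphism embedM.

Lemma embed_inj : ('injm embed)%g.
Proof.
apply/injmP => A B _ _ /eqP/pgl_eqP[c AB]; apply: val_inj; exact: (block1_inj AB).
Qed.
End Embedding.

(** * Commuting projectivities *)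

Section Pgl.
Variable F : finFieldType.
Implicit Types u v : {'GL_3[F]}.

Lemma proj_mx3_pgl u : exists2 c, c != 0 & proj_mx3 (pgl u) = c *: GLval u.
Proof.
have /eqP/pgl_eqP[c cE] := pgl_repr (pgl u); exists c => //.
apply/eqP => c0; have := GL_det (repr (pgl u)).
by rewrite cE c0 scale0r det0 eqxx.
Qed.

Lemma fixes_pointP u (P : 'rV[F]_3) : P != 0 ->
  reflect (exists d, P *m GLval u = d *: P) (fixes_point (pgl u) P).
Proof.
move=> P0; apply: (iffP idP) => [|[d dE]];
  have [c c0 cE] := proj_mx3_pgl u; rewrite /fixes_point cE -scalemxAr.
  case/andP=> /sub_rVP[d dE] _; exists (c^-1 * d).
  by rewrite -scalerA -dE scalerA mulVf // scale1r.
have d0 : d != 0.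
  apply: contraNneq P0 => d0; move: dE; rewrite d0 scale0r => /(congr1 (mulmx^~ (invmx u))).
  by rewrite mul0mx mulmxK ?GL_unitmx // => ->.
rewrite dE scalerA; apply/andP; split; first exact: scalemx_sub.
by apply/sub_rVP; exists (c * d)^-1; rewrite scalerA mulVf ?scale1r // mulf_neq0.
Qed.

(** If u v = c v u, then v^2 = 1 gives c^2 = 1, and comparing determinants
    gives c^3 = 1. *)
Lemma commute_involution u v : (v * v = 1)%g -> commute (pgl u) (pgl v) ->
  GLval u *m GLval v = GLval v *m GLval u.
Proof.
move=> vv; rewrite /commute -!pglM => /eqP/pgl_eqP[c]; rewrite !GL_MxE => uv.
suff c1 : c = 1 by rewrite c1 scale1r in uv.
have c2 : c * c = 1.
  have vv1 : GLval v *m GLval v = 1%:M by rewrite -GL_MxE vv.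
  have : GLval u = (c * c) *: GLval u.
    rewrite -{1}[GLval u]mulmx1 -vv1 mulmxA uv -scalemxAl -mulmxA uv -scalemxAr.
    by rewrite mulmxA vv1 mul1mx scalerA.
  move/(congr1 (mulmx^~ (invmx u))); rewrite -scalemxAl mulmxV ?GL_unitmx //.
  by move/matrixP/(_ 0 0); rewrite !mxE mulr1.
have : c ^+ 3 = 1.
  have /(congr1 determinant) := uv; rewrite detZ !det_mulmx [\det (GLval v) * _]mulrC.
  rewrite -{1}[_ * _]mul1r => /mulIf <- //.
  by rewrite mulf_neq0 ?(GL_det u) ?(GL_det v).
by rewrite !exprS mulrA c2 mul1r mulr1.
Qed.
End Pgl.

(** * The group of the curve, and the subgroups M_q and H *)

Lemma herm_mx_neq0_det (F : fieldType) (w : F) : w != 0 -> \det (herm_mx w) != 0.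
Proof. by move/herm_mx_unit; rewrite unitmxE unitfE. Qed.

Section PGU.
Variables (F : finFieldType) (K : fieldType) (iota : {rmorphism F -> K}).
Variables (s : {rmorphism F -> F}) (t : {rmorphism K -> K}) (q : nat) (w : F).
Hypotheses (sE : forall x, s x = x ^+ q) (tE : forall x, t x = x ^+ q).
Hypotheses (sK : involutive s) (two0 : (2 : F) != 0) (sw : s w = - w) (w0 : w != 0).
Local Notation J := (herm_mx w).
Local Notation "''P0'" := (P0 F) (at level 0).
Implicit Type u : {'GL_3[F]}.
Implicit Type v : 'rV[F]_3.

Lemma herm_eq_map (v : 'rV[F]_3) :
  herm_eq q (iota w) (map_mx iota v) = iota (sform s J v v).
Proof.
rewrite -(herm_eqE w v sE) /herm_eq !mxE.
by rewrite rmorphD rmorphB !rmorphM !rmorphXn.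
Qed.

Lemma herm_form_map (u v : 'rV[F]_3) :
  herm_form q (iota w) (map_mx iota u) (map_mx iota v) = iota (sform s J u v).
Proof.
rewrite -(herm_formE w u v sE) /herm_form !mxE.
by rewrite rmorphD rmorphB !rmorphM !rmorphXn.
Qed.

Lemma similitude_neq0 c u : similitude s J c (GLval u) -> c != 0.
Proof.
move=> simu; apply/eqP => c0; move: simu; rewrite /similitude c0 scale0r.
move/(congr1 determinant)/eqP; rewrite !det_mulmx det_tr det_map_mx det0.
by rewrite !mulf_eq0 fmorph_eq0 (negbTE (herm_mx_neq0_det w0)) (negbTE (GL_det u)).
Qed.

(** For the direct implication, the forms with matrices J and M J M^* have the
    same isotropic vectors over F.  For the converse, the relation
    M J M^* = c J is transported to K, where s becomes t. *)
Lemma mem_PGU3 u :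
  pgl u \in PGU3 iota q (iota w) <-> exists c, similitude s J c (GLval u).
Proof.
have [c c0 cE] := proj_mx3_pgl u; rewrite inE; split=> [/asboolP curve|[d simu]].
  exists ((GLval u *m J *m adjmx s (GLval u)) 0 1); rewrite /similitude.
  apply: (isotropic_proportional sK two0 sw w0) => [|v vJ].
    by rewrite !adjmxM adjmxK // adj_herm_mx // mulNmx mulmxN mulmxA.
  have -> : sform s (GLval u *m J *m adjmx s (GLval u)) v v =
            sform s J (v *m GLval u) (v *m GLval u).
    by rewrite /sform adjmxM !mulmxA.
  have [->|v0] := eqVneq v 0; first by rewrite /sform !mul0mx mxE.
  have := curve (map_mx iota v); rewrite map_mx_eq0 v0 => /(_ isT).
  rewrite -map_mxM /on_hermitian !herm_eq_map vJ rmorph0 eqxx cE -scalemxAr.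
  rewrite sformZl sformZr fmorph_eq0 !mulf_eq0 fmorph_eq0 (negbTE c0) /=.
  by move/eqP.
have := similitudeZ c simu; rewrite -cE => simc.
apply/asboolP => v _; rewrite /on_hermitian !(herm_eqE _ _ tE).
have JE : herm_mx (iota w) = map_mx iota J.
  rewrite !herm_mxE; apply/matrixP => i k; rewrite !mxE.
  case: i => [[|[|[|[]]]]] //= _; case: k => [[|[|[|[]]]]] //= _;
    by rewrite ?rmorphN ?rmorph1 ?rmorph0.
have simK : similitude t (herm_mx (iota w)) (iota (c * s c * d))
    (map_mx iota (proj_mx3 (pgl u))).
  rewrite /similitude (_ : adjmx t _ = map_mx iota (adjmx s (proj_mx3 (pgl u)))).
    by rewrite JE -!map_mxM simc map_mxZ.
  by apply/matrixP => i k; rewrite !mxE tE sE rmorphXn.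
rewrite (sform_similitude _ _ simK) mulf_eq0 fmorph_eq0 !mulf_eq0 fmorph_eq0.
by rewrite (negbTE c0) (negbTE (similitude_neq0 simu)).
Qed.

Lemma sform_P0 v : sform s J v 'P0 = w * v 0 2.
Proof.
by rewrite sform3E herm_mxE !mxE /= !rmorph0 rmorph1; ring.
Qed.

Lemma P0_neq0 : 'P0 != 0.
Proof. by apply/eqP => /rowP/(_ 2)/eqP; rewrite !mxE oner_eq0. Qed.

(** After division by d, the matrix is an isometry fixing P0, so it also
    preserves the polar line Z = 0. *)
Lemma fixes_P0_block1 c u d : similitude s J c (GLval u) ->
  'P0 *m GLval u = d *: 'P0 ->
  d != 0 /\ exists2 A, similitude s (skew2 F) 1 A & GLval u = d *: block1 A.
Proof.
move=> simu P0u; have formP0 : sform s J 'P0 'P0 = w by rewrite sform_P0 mxE mulr1.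
have cE : c = d * s d.
  by apply: similitude_eigen simu _ P0u; rewrite formP0.
have d0 : d != 0.
  by apply: contraNneq (similitude_neq0 simu) => d0; rewrite cE d0 mul0r.
split=> //; pose M := d^-1 *: GLval u.
have simM : similitude s J 1 M.
  have := similitudeZ d^-1 simu; rewrite cE fmorphV.
  by rewrite mulrACA mulVf // mulVf ?fmorph_eq0 // mulr1.
have P0M : 'P0 *m M = 'P0 by rewrite -scalemxAr P0u scalerA mulVf // scale1r.
have uM : GLval u = d *: M by rewrite scalerA mulfV // scale1r.
clearbody M; have M2 v : (v *m M) 0 2 = v 0 2.
  apply: (mulfI w0); rewrite -!sform_P0 -[in LHS]P0M.
  by rewrite (sform_similitude _ _ simM) mul1r.
have ME : M = block1 (@ulsubmx _ 2 1 2 1 M).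
  apply: etrans (esym (@submxK _ 2 1 2 1 M)) _; rewrite /block1.
  have I1 (i : 'I_1) : rshift 2 i = 2 :> 'I_3 by rewrite ord1; apply: val_inj.
  have Mi2 i : M i 2 = (i == 2)%:R.
    have := M2 (delta_mx 0 i); rewrite -rowE !mxE => ->.
    by rewrite eqxx eq_sym.
  have M2k k : M 2 k = (k == 2)%:R.
    have /rowP/(_ k) := P0M; rewrite -rowE !mxE => ->.
    by rewrite eqxx.
  apply: (f_equal4 (@block_mx F 2 1 2 1)) => //; apply/matrixP => i k; rewrite !mxE I1.
  - by rewrite Mi2; case: i => [[|[|[]]]].
  - by rewrite M2k; case: k => [[|[|[]]]].
  by rewrite I1 Mi2 !ord1.
exists (@ulsubmx _ 2 1 2 1 M); last by rewrite -ME.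
by apply/(similitude_block1 s w); rewrite -ME.
Qed.

Lemma P0_block1 A : 'P0 *m block1 A = 'P0 :> 'rV[F]_3.
Proof.
have -> : 'P0 = row_mx 0 1%:M :> 'rV_(2 + 1).
  apply: etrans (esym (@hsubmxK _ 1 2 1 'P0)) _.
  apply: (f_equal2 (@row_mx F 1 2 1)); apply/rowP => i; rewrite !mxE /=.
    by case: i => [[|[|[]]]].
  by rewrite [i]ord1.
rewrite /block1 (@mul_row_block _ 1 2 1 2 1).
by rewrite !(mulmx0, mul0mx, mul1mx, add0r, addr0).
Qed.

Lemma embed_Mq A : A \in unitary2 s -> embed A \in Mq iota q (iota w).
Proof.
move/unitary2P=> UA; rewrite in_set; apply/andP; split.
  by apply/mem_PGU3; exists 1; apply/similitude_block1.
by apply/(fixes_pointP _ P0_neq0); exists 1; rewrite P0_block1 scale1r.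
Qed.

Lemma Mq_embed : Mq iota q (iota w) = (@embed F @* unitary2 s)%g.
Proof.
apply/setP => g; apply/idP/morphimP => [|[A _ UA ->]]; last exact: embed_Mq.
rewrite -(pgl_repr g); move: (repr g) => u {g}.
rewrite in_set => /andP[/mem_PGU3[c simu] /(fixes_pointP _ P0_neq0)[d dE]].
have [d0 [A simA uE]] := fixes_P0_block1 simu dE.
have A_unit : A \is a GRing.unit.
  have := GL_unitmx u; rewrite -[val u]/(GLval u) uE unitmxZ ?unitfE //.
  by rewrite !unitmxE (@det_ublock _ 2 1) det1 mulr1.
exists (FinRing.Unit A_unit); [exact: in_setT | exact/unitary2P |].
by apply/eqP/pgl_eqP; exists d.
Qed.

Lemma Hq_embed (Fq : finFieldType) (j : {rmorphism Fq -> F}) : #|Fq| = q ->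
  Hq j iota q (iota w) = (@embed F @* special_unitary2 s)%g.
Proof.
move=> cardFq; rewrite -(map_SL2 j cardFq sE); apply/setP => g; rewrite in_set.
apply/andP/morphimP => [[_ /existsP[A /andP[/eqP dA /existsP[u /andP[ug /eqP uE]]]]]|].
  have A_unit : A \is a GRing.unit.
    by rewrite (_ : (_ \is a _) = (A \in unitmx)) // unitmxE dA unitr1.
  pose A' : {'GL_2[Fq]} := FinRing.Unit A_unit.
  exists (map_GL2 j A'); first exact: in_setT.
    by apply: mem_morphim; rewrite inE //= dA.
  rewrite -(coset_mem ug); apply/eqP/pgl_eqP; exists 1; rewrite scale1r.
  exact: uE.
case=> B _ SB ->; have UB : B \in unitary2 s.
  by move: SB; rewrite (map_SL2 j cardFq sE) special_unitary2E => /andP[].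
split; first exact: embed_Mq.
case/morphimP: SB => A _; rewrite inE => dA BE.
apply/existsP; exists (GLval A); rewrite dA /=.
apply/existsP; exists (embed3 (map_GL2 j A)); rewrite BE eqxx andbT.
have uN := GL3_norm (embed3 (map_GL2 j A)).
by have := rcoset_refl 'Z('GL_3[F]) (embed3 (map_GL2 j A)); rewrite -(val_coset uN).
Qed.

Section ScalarOnPolar.
Variables (P : 'rV[F]_3) (P_P0 : sform s J P 'P0 = 0).

(** Let v be orthogonal to P and P0.  If b != 0 and v + b P0 is not isotropic,
    then it is an eigenvector; so is P0, and comparing the components along P0
    shows that the two eigenvalues are equal.  The scalar k, whose norm is not
    1, is there because v + P0 may be isotropic; in that case v + k P0 is
    not. *)
Lemma scalar_on_polar M c d k : k * s k != 1 -> k != 0 ->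
  similitude s J c M -> d != 0 -> 'P0 *m M = d *: 'P0 ->
  (forall v, sform s J v P = 0 -> sform s J v v != 0 ->
     exists e, v *m M = e *: v) ->
  forall v, sform s J v P = 0 -> v *m M = d *: v.
Proof.
move=> k1 k0 simM d0 P0M eigM.
have skew := sform_skew sK (adj_herm_mx sw).
have P0P : sform s J 'P0 P = 0 by rewrite skew P_P0 rmorph0 oppr0.
have P00 : sform s J 'P0 'P0 = w by rewrite sform_P0 mxE mulr1.
have perp v : sform s J v P = 0 -> sform s J v 'P0 = 0 -> v *m M = d *: v.
  move=> vP vP0; have P0v : sform s J 'P0 v = 0 by rewrite skew vP0 rmorph0 oppr0.
  have normE b : sform s J (v + b *: 'P0) (v + b *: 'P0) = sform s J v v + b * s b * w.
    rewrite !(sformDl, sformDr, sformZl, sformZr) vP0 P0v P00; ring.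
  have [b b0 vb] : exists2 b, b != 0 & sform s J (v + b *: 'P0) (v + b *: 'P0) != 0.
    have [E|] := eqVneq (sform s J (v + 1 *: 'P0) (v + 1 *: 'P0)) 0; last first.
      by exists 1; rewrite ?oner_eq0.
    exists k => //; move: E; rewrite !normE rmorph1 !mul1r => /eqP.
    rewrite addr_eq0 => /eqP->; rewrite addrC -[X in _ - X]mul1r -mulrBl.
    by rewrite mulf_neq0 // subr_eq0.
  have vMP0 : sform s J (v *m M) 'P0 = 0.
    have := sform_similitude v 'P0 simM; rewrite P0M sformZr vP0 mulr0 => /eqP.
    by rewrite mulf_eq0 fmorph_eq0 (negbTE d0) => /eqP.
  have [|e eE] := eigM (v + b *: 'P0) _ vb.
    by rewrite sformDl sformZl vP P0P mulr0 addr0.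
  have ed : e = d.
    have := congr1 (sform s J ^~ 'P0) eE; rewrite mulmxDl -scalemxAl P0M.
    rewrite !(sformDl, sformZl) vMP0 vP0 P00 !add0r mulrCA.
    by move/(mulIf (mulf_neq0 b0 w0)).
  move: eE; rewrite mulmxDl -scalemxAl P0M scalerDr !scalerA ed mulrC.
  by move/addIr.
move=> v vP; pose b := sform s J v 'P0 / w.
have : (v - b *: 'P0) *m M = d *: (v - b *: 'P0).
  apply: perp; rewrite -scaleNr sformDl sformZl ?P0P ?mulr0 ?addr0 //.
  by rewrite P00 mulNr divfK // subrr.
by rewrite mulmxBl -scalemxAl P0M scalerBr !scalerA mulrC => /addIr.
Qed.

End ScalarOnPolar.

End PGU.

(** * The centralizer of a polar involution *)

Section InvolutionCentralizer.
Variables (F : finFieldType) (K : fieldType) (iota : {rmorphism F -> K}).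
Variables (s : {rmorphism F -> F}) (t : {rmorphism K -> K}) (q : nat) (w : F).
Hypotheses (sE : forall x, s x = x ^+ q) (tE : forall x, t x = x ^+ q).
Hypotheses (sK : involutive s) (two0 : (2 : F) != 0) (sw : s w = - w) (w0 : w != 0).
Variables (z k : F) (zP : q.+1.-primitive_root z) (k1 : k * s k != 1) (k0 : k != 0).
Local Notation J := (herm_mx w).
Local Notation "''P0'" := (P0 F) (at level 0).
Local Notation G := (PGU3 iota q (iota w)).
Variables (P : 'rV[F]_3) (P_aniso : sform s J P P != 0) (P_P0 : sform s J P 'P0 = 0).
Variables (u r : {'GL_3[F]}).
Hypotheses (uE : GLval u = homology s J P z) (rE : GLval r = homology s J P (-1)).
Let Jskew := adj_herm_mx sw.
Let memG v := mem_PGU3 iota sE tE sK two0 sw w0 v.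

Lemma opp1_neq1 : -1 != 1 :> F.
Proof. by rewrite eq_sym -subr_eq0 opprK. Qed.

Lemma homology_involution (v : {'GL_3[F]}) b : sform s J b b != 0 ->
  GLval v = homology s J b (-1) -> (v * v = 1)%g.
Proof.
move=> b0 vE; apply: val_inj; rewrite -[LHS]/(GLval (v * v)%g) GL_MxE vE homologyM //.
by rewrite mulrNN mulr1 homology1.
Qed.

Lemma homology_PGU3 (v : {'GL_3[F]}) b x : sform s J b b != 0 -> x * s x = 1 ->
  GLval v = homology s J b x -> pgl v \in G.
Proof.
by move=> b0 x1 vE; apply/memG; exists 1; rewrite vE; apply: homology_isometry.
Qed.

(** Commuting projectivities have commuting matrices here, as [r] is an
    involution as a matrix. *)
Lemma mem_involution_centralizer v : (pgl v \in 'C_G[pgl r])%g <->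
  pgl v \in G /\ GLval v *m GLval r = GLval r *m GLval v.
Proof.
split=> [/setIP[Gv /cent1P rv]|[Gv rv]].
  split=> //; apply: (commute_involution (homology_involution P_aniso rE)).
  exact: commute_sym.
apply/setIP; split=> //; apply/cent1P; rewrite /commute -!pglM; congr pgl.
by apply: val_inj; apply: esym.
Qed.

(** A central element v commutes with the homologies of ratio -1 centered at
    the non-isotropic points b orthogonal to P, since they belong to the
    centralizer; therefore v fixes these points, and it is a scalar d on the
    polar of P.  With P v = e P, the similitude v has multiplier
    e s(e) = d s(d), so that e / d is a power of z. *)
Lemma center_involution_centralizer : 'Z('C_G[pgl r])%g = <[pgl u]>%g.
Proof.
have uX i : GLval (u ^+ i)%g = homology s J P (z ^+ i).
  elim: i => [|i IHi]; first by rewrite GL_1E homology1.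
  by rewrite expgS GL_MxE IHi uE exprS -homologyM.
have pglX i : pgl (u ^+ i)%g = (pgl u ^+ i)%g.
  elim: i => [|i IHi]; last by rewrite !expgS pglM IHi.
  by rewrite !expg0 /pgl morph1.
have zX i : z ^+ i * s (z ^+ i) = 1.
  by rewrite sE -exprS exprAC (prim_expr_order zP) expr1n.
apply/setP => g; apply/setIP/cycleP => [[]|[i ->{g}]]; last first.
  rewrite -pglX; split.
    apply/mem_involution_centralizer; split; first exact: homology_PGU3 (zX i) (uX i).
    by rewrite uX rE !homologyM // mulrC.
  apply/centP => g; rewrite -(pgl_repr g); move: (repr g) => v {g}.
  case/mem_involution_centralizer => _; rewrite rE.
  move/(commute_homology (z ^+ i) P_aniso opp1_neq1).
  rewrite -uX => vu; rewrite /commute -!pglM; congr pgl.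
  by apply: val_inj; apply: esym.
rewrite -(pgl_repr g); move: (repr g) => v {g} Cv /centP cv.
have [/memG[c simv]] := (mem_involution_centralizer v).1 Cv; rewrite rE => rv.
have c0 := similitude_neq0 w0 simv.
have [e Pv] := commute_homology_center P_aniso opp1_neq1 rv.
have ce := similitude_eigen simv P_aniso Pv.
have eig b : sform s J b P = 0 -> sform s J b b != 0 -> exists d, b *m GLval v = d *: b.
  move=> bP b0; have Pb : sform s J P b = 0.
    by rewrite (sform_skew sK Jskew) bP rmorph0 oppr0.
  have N0 : -1 != 0 :> F by rewrite oppr_eq0 oner_eq0.
  have /= rb_unit : homology s J b (-1) \is a GRing.unit := homology_unit b0 N0.
  pose rb : {'GL_3[F]} := FinRing.Unit rb_unit.
  apply: (commute_homology_center b0 opp1_neq1).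
  apply: (commute_involution (v := rb)); first exact: (homology_involution b0).
  apply: cv; apply/mem_involution_centralizer; split.
    by apply: (homology_PGU3 (v := rb) (x := -1) b0) => //; rewrite rmorphN1 mulrNN mulr1.
  by rewrite rE; apply: homology_commute_orth.
have P0P : sform s J 'P0 P = 0 by rewrite (sform_skew sK Jskew) P_P0 rmorph0 oppr0.
have P00 : sform s J 'P0 'P0 != 0 by rewrite sform_P0 mxE mulr1.
have [d P0v] := eig _ P0P P00.
have cd := similitude_eigen simv P00 P0v.
have d0 : d != 0 by apply: contraNneq c0 => d0; rewrite cd d0 mul0r.
have polar := scalar_on_polar sK sw w0 P_P0 k1 k0 simv d0 P0v eig.
have vE := scalar_on_axis_homology P_aniso d0 Pv polar.
have [|i iE] := prim_rootP zP (x := e / d).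
  rewrite exprS -sE fmorph_div mulrACA -ce cd -invfM mulfV //.
  by rewrite mulf_neq0 ?fmorph_eq0.
by exists i; rewrite -pglX; apply/eqP/pgl_eqP; exists d; rewrite uX -iE.
Qed.

(** A similitude that is scalar on the polar of P fixes P: the component y
    along this polar of the image of P is orthogonal to all vectors.  It is
    thus a homology, whose ratio is a square root of 1 other than 1. *)
Lemma polar_involution_unique g : g \in G -> #[g]%g = 2%N ->
  (forall b, sform s J b P = 0 -> b != 0 -> fixes_point g b) -> g = pgl r.
Proof.
rewrite -(pgl_repr g); move: (repr g) => v {g} Gv gv2 fix_axis.
have [c simv] := (memG v).1 Gv.
have c0 := similitude_neq0 w0 simv.
have eig b : sform s J b P = 0 -> exists d, b *m GLval v = d *: b.
  move=> bP; have [->|b0] := eqVneq b 0; first by exists 0; rewrite mul0mx scaler0.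
  exact/(fixes_pointP _ b0)/fix_axis.
have skew := sform_skew sK Jskew.
have P0P : sform s J 'P0 P = 0 by rewrite skew P_P0 rmorph0 oppr0.
have P00 : sform s J 'P0 'P0 != 0 by rewrite sform_P0 mxE mulr1.
have [d P0v] := eig _ P0P.
have cd := similitude_eigen simv P00 P0v.
have d0 : d != 0 by apply: contraNneq c0 => d0; rewrite cd d0 mul0r.
have polar := scalar_on_polar sK sw w0 P_P0 k1 k0 simv d0 P0v (fun b bP _ => eig b bP).
have [e Pv] : exists e, P *m GLval v = e *: P.
  pose e := sform s J (P *m GLval v) P / sform s J P P; exists e.
  pose y := P *m GLval v - e *: P.
  have yP : sform s J y P = 0 by rewrite /y -scaleNr sformDl sformZl mulNr divfK // subrr.
  have yperp b : sform s J b P = 0 -> sform s J y b = 0.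
    move=> bP; have Pb : sform s J P b = 0 by rewrite skew bP rmorph0 oppr0.
    have := sform_similitude P b simv; rewrite Pb mulr0 (polar _ bP) sformZr => /eqP.
    rewrite mulf_eq0 fmorph_eq0 (negbTE d0) /= => /eqP Pvb.
    by rewrite /y -scaleNr sformDl sformZl Pvb Pb mulr0 addr0.
  have y_all b : sform s J y b = 0.
    pose m := sform s J b P / sform s J P P.
    have -> : b = (b - m *: P) + m *: P by rewrite subrK.
    rewrite sformDr sformZr yP mulr0 addr0 yperp //.
    by rewrite -scaleNr sformDl sformZl mulNr divfK // subrr.
  suff y0 : y = 0 by apply/eqP; rewrite -subr_eq0 -/y y0.
  have : y *m J = 0.
    apply/rowP => i; rewrite [RHS]mxE -(y_all (delta_mx 0 i)) /sform.
    by rewrite /adjmx map_delta_mx trmx_delta -colE [RHS]mxE.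
  by move/(congr1 (mulmx^~ (invmx J))); rewrite mul0mx mulmxK // herm_mx_unit.
have vE := scalar_on_axis_homology P_aniso d0 Pv polar.
have : (e / d) * (e / d) = 1.
  have /eqP/pgl_eqP[m] : pgl (v * v)%g = pgl 1%g.
    have := expg_order (pgl v); rewrite gv2 pglM => g2.
    by apply: etrans (esym (morph1 (coset_morphism _))); apply: g2.
  rewrite GL_MxE GL_1E vE -scalemxAl -scalemxAr homologyM // => E.
  have := congr1 (mulmx 'P0) E; have := congr1 (mulmx P) E.
  rewrite -!scalemxAr !mulmx1 homology_center // homology_axis // !scalerA.
  have cancel (b : 'rV[F]_3) x y : sform s J b b != 0 -> x *: b = y *: b -> x = y.
    move=> b0 /(congr1 (sform s J ^~ b)); rewrite !sformZl; exact: mulIf.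
  move=> /(cancel _ _ _ P_aniso) <- /(cancel _ _ _ P00)/esym.
  by rewrite -[RHS]mulr1 => /(mulfI (mulf_neq0 d0 d0)).
have v1 : GLval v <> d *: 1%:M.
  move=> v1; suff g1 : pgl v = 1%g by rewrite g1 order1 in gv2.
  rewrite -[1%g](morph1 (coset_morphism _)); apply/eqP/pgl_eqP; exists d.
  by rewrite v1 GL_1E.
move/eqP; rewrite -expr2 sqrf_eq1 => /orP[] /eqP ed; rewrite ed in vE.
  by case: v1; rewrite vE homology1.
by apply/eqP/pgl_eqP; exists d; rewrite rE vE.
Qed.

End InvolutionCentralizer.

(** * The decomposition of M_q *)

Lemma sub_ell_row_mx (F : finFieldType) (P : 'rV[F]_3) :
  (P <= ell F)%MS -> exists a : 'rV[F]_2, P = (row_mx a 0 : 'rV_(2 + 1)).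
Proof.
case/submxP=> D ->; exists (@lsubmx _ 1 2 1 (D *m ell F)).
apply: etrans (esym (@hsubmxK _ 1 2 1 _)) _; congr row_mx.
apply/rowP => i; rewrite !mxE big1 // => -[[|[|[|//]]] /= ?] _;
  by rewrite !mxE ?andbF ?mulr0.
Qed.

Theorem proposition3p1 (p h q : nat)
    (p_prime : prime p) (p_odd : odd p) (h_gt0 : (0 < h)%N)
    (qE : q = (p ^ h)%N)
    (Fq F : finFieldType) (cardFq : #|Fq| = q) (cardF : #|F| = (q ^ 2)%N)
    (j : {rmorphism Fq -> F})
    (K : closedFieldType) (iota : {rmorphism F -> K})
    (K_alg : forall x : K, algebraicOver iota x)
    (omega : K) (omegaE : omega ^+ q.-1 = -1)
    (P' : 'rV[F]_3) (l' : 'M[F]_3) (tau' : PGL3 F)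
    (P'_neq0 : P' != 0)
    (P'_ell : (P' <= ell F)%MS)
    (P'_notin_curve : ~~ on_hermitian q omega (map_mx iota P'))
    (l'_polar : is_polar_line iota q omega P' l')
    (tau'_PGU : tau' \in PGU3 iota q omega)
    (tau'_invol : #[tau']%g = 2%N)
    (tau'_homology : is_homology tau' P' l') :
  let H := Hq j iota q omega in
  let Z := 'Z('C_(PGU3 iota q omega)[tau'])%g in
  [/\ (H ><| Z = Mq iota q omega)%g,
      (H \isog SL2 Fq)%g,
      cyclic Z
    & #|Z| = q.+1].
Proof.
move=> H Z.
have oq : odd q by rewrite qE oddX p_odd orbT.
have q_gt0 : (0 < q)%N by rewrite qE expn_gt0 prime_gt0.
have q_gt1 : (1 < q)%N by rewrite qE -(exp1n h) ltn_exp2r ?prime_gt1.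
have Fp : p \in [char F].
  by apply: (@card_finPcharP F p (h * 2)); rewrite // cardF qE expnM.
have [s] := frobenius_power h Fp; rewrite -qE => sE.
have [t] := frobenius_power h (rmorph_pchar iota Fp); rewrite -qE => tE.
have sK : involutive s by move=> x; rewrite !sE -exprM mulnn -cardF expf_card.
have [w wE w1] := omega_rational cardF iota oq omegaE.
have sw : s w = - w by rewrite sE -(prednK q_gt0) exprS w1 mulrN1.
have w0 : w != 0.
  apply: contra_eq_neq w1 => ->; rewrite expr0n -(subnKC q_gt1) /= eq_sym.
  by rewrite oppr_eq0 oner_eq0.
have two0 : (2 : F) != 0.
  rewrite -(dvdn_pcharf Fp) gtnNdvd // ltn_neqAle prime_gt1 // andbT.
  by apply: contraTneq p_odd => <-.
have [z zP] := norm1_prim_root cardF.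
have [g gP] := finField_prim_root F.
have k1 : g * s g != 1.
  rewrite sE -exprS -(prim_order_dvd gP) (card_sq_pred cardF).
  rewrite gtnNdvd // -{1}[q.+1]mul1n ltn_pmul2r // ltn_predRL.
  by rewrite ltn_neqAle q_gt1 andbT; apply: contraTneq oq => <-.
have k0 : g != 0.
  by rewrite (prim_root_eq0 gP) -lt0n (prim_order_gt0 gP).
subst omega.
have [a PE] := sub_ell_row_mx P'_ell.
have P_aniso : sform s (herm_mx w) P' P' != 0.
  by move: P'_notin_curve; rewrite /on_hermitian (herm_eq_map iota w sE) fmorph_eq0.
have a_aniso : sform s (skew2 F) a a != 0.
  by rewrite -(sform_row_mx0 s w) -PE.
have P_P0 : sform s (herm_mx w) P' (P0 F) = 0.
  rewrite sform_P0 PE (_ : 2 = rshift 2 0 :> 'I_(2 + 1)); last exact: val_inj.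
  by rewrite (@row_mxEr _ 1 2 1) mxE mulr0.
have z0 : z != 0 by rewrite (prim_root_eq0 zP).
have N0 : -1 != 0 :> F by rewrite oppr_eq0 oner_eq0.
pose u2 : {'GL_2[F]} := FinRing.Unit (homology_unit a_aniso z0 : _ \is a GRing.unit).
pose r : {'GL_3[F]} := FinRing.Unit (homology_unit P_aniso N0 : _ \is a GRing.unit).
have uE : GLval (embed3 u2) = homology s (herm_mx w) P' z.
  by rewrite PE homology_block1.
have tauE : tau' = pgl r.
  apply: (polar_involution_unique (iota := iota) sE tE sK two0 sw w0 k1 k0
            P_aniso P_P0 (r := r)) => // b bP b0.
  case: tau'_homology => _ _; apply=> //.
  by case: l'_polar => _ ->; rewrite (herm_form_map iota w sE) bP rmorph0.
have ZE : Z = (@embed F @* <[u2]>)%g.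
  rewrite /Z tauE (center_involution_centralizer iota sE tE sK two0 sw w0 zP
    k1 k0 P_aniso P_P0 uE) //.
  by rewrite morphim_cycle ?inE.
have [sdU ou] := special_unitary2_sdprod sK sE zP a_aniso (erefl : GLval u2 = _).
have HE : H = (@embed F @* special_unitary2 s)%g :=
  Hq_embed iota sE tE sK two0 sw w0 j cardFq.
rewrite -/H -/Z HE ZE; split.
- rewrite (Mq_embed iota sE tE sK two0 sw w0).
  exact: (injm_sdprod (subsetT _) (@embed_inj F) sdU).
- rewrite -(map_SL2 j cardFq sE) isog_symr //.
  apply: (isog_trans (sub_isog (subsetT _) (map_GL2_inj j))).
  exact: (sub_isog (subsetT _) (@embed_inj F)).
- by rewrite morphim_cyclic ?cycle_cyclic.
by rewrite card_injm ?embed_inj ?subsetT // -orderE ou.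
Qed.
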